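(* Let $\Gamma$ be a connected graph. If $\Gamma$ is hyperbolic, then $\mathsf{sCop}(\Gamma)=1$.
   Context: Graphs are undirected, without double edges and without loops. For a connected graph $\Gamma$, $\mathsf{dist}$ is the path distance on $V(\Gamma)$. Game. The cops and robber game on a connected graph $\Gamma$ has parameters: number of cops $n$, cop speed $\sigma$, cop reach $\rho$, robber speed $\psi$, a vertex $v$, and a positive integer $R$. It is a perfect information game. First the $n$ cops choose initial vertices $c^1_0,\dots,c^n_0$; then, knowing these, the robber chooses an initial vertex $r_0$. In stage $k\ge 1$ each cop moves from $c^i_{k-1}$ to a vertex $c^i_k$ with $\mathsf{dist}(c^i_{k-1},c^i_k)\le\sigma$. The robber is captured during stage $k$ if $\mathsf{dist}(r_{k-1},c^i_k)\le\rho$ for some $i$. If not captured, the robber moves from $r_{k-1}$ to a vertex $r_k$ such that there is a path from $r_{k-1}$ to $r_k$ of length at most $\psi$ all of whose vertices are at distance larger than $\rho$ from every $c^i_k$. The cops win (protect the $R$-ball centered at $v$) if the robber is captured at some stage or there is $N>0$ such that $\mathsf{dist}(v,r_k)>R$ for all $k\ge N$. $\Gamma$ is $\mathsf{CopWin}(n,\sigma,\rho,\psi,R)$ if for every vertex $v$ of $\Gamma$ the $n$ cops have a winning strategy in the game with parameters $n,\sigma,\rho,\psi,v,R$. $\Gamma$ is $n$-strong cop win if $\exists\,\sigma\in\mathbb{Z}_{>0}\ \forall\,\psi\in\mathbb{Z}_{>0}\ \exists\,\rho\in\mathbb{Z}_{\ge0}\ \forall\,R\in\mathbb{Z}_{>0}$: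 $\Gamma$ is $\mathsf{CopWin}(n,\sigma,\rho,\psi,R)$. The strong cop number $\mathsf{sCop}(\Gamma)\in\mathbb{Z}_{>0}\cup\{\infty\}$ is the smallest positive integer $n$ such that $\Gamma$ is $n$-strong cop win, and $\infty$ if there is none. Hyperbolic graph: a connected graph is regarded as a geodesic metric space by making each edge a segment of length one with the path metric. A geodesic metric space is $\delta$-hyperbolic if every geodesic triangle is $\delta$-slim, i.e. each side is contained in the $\delta$-neighborhood of the union of the other two sides; it is hyperbolic if it is $\delta$-hyperbolic for some $\delta\ge0$. *)

(* Defs.v *)
From mathcomp Require Import all_boot all_order all_algebra.
From mathcomp Require Import boolp classical_sets set_interval reals.

Set Implicit Arguments.
Unset Strict Implicit.
Unset Printing Implicit Defensive.

Import Order.TTheory GRing.Theory Num.Theory.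

Local Open Scope classical_set_scope.
Local Open Scope ring_scope.

(* Minimum of a set of natural numbers, [None] (read as infinity) if empty. *)
Definition least (P : nat -> Prop) : option nat :=
  if pselect (exists n, `[< P n >]) is left exP then Some (ex_minn exP)
  else None.

(* Possibly infinite, not necessarily locally finite, simple graphs. *)
Record graph := Graph {
  vertex :> Type;
  adj : rel vertex;
  adj_sym : symmetric adj;
  adj_irrefl : irreflexive adj }.

Arguments adj {g}.

Section PathDistance.
Variable G : graph.

(* The vertices of the path are those of [u :: p]; its length is [size p]. *)
Definition is_path (u v : G) (p : seq G) : Prop := path adj u p /\ last u p = v.

Definition connected_graph : Prop := forall u v : G, exists p, is_path u v p.

(* The default value 0 is only used when [u] and [v] are not connected. *)
Definition dist (u v : G) : nat :=
  odflt 0%N (least (fun k => exists2 p, is_path u v p & size p = k)).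

End PathDistance.

Section CopsAndRobber.
Variable G : graph.

(* A strategy sends the robber's past positions [:: r_0; ...; r_(k-1)] to the
   positions c_k of the cops, the empty history giving the initial positions.
   Past cop positions need not be arguments: the strategy determines them. *)
Record strategy (n sigma : nat) := Strategy {
  cops_at :> seq G -> 'I_n -> G;
  cops_speed : forall h r i,
    (dist (cops_at h i) (cops_at (rcons h r) i) <= sigma)%N }.

Definition out_of_reach n (rho : nat) (c : 'I_n -> G) (x : G) : Prop :=
  forall i, (rho < dist x (c i))%N.

Definition robber_move n (rho psi : nat) (c : 'I_n -> G) (r r' : G) : Prop :=
  exists p, [/\ is_path r r' p, (size p <= psi)%N
    & forall j, (j <= size p)%N -> out_of_reach rho c (nth r (r :: p) j)].

(* In stage k.+1 the robber is at [r k] and the cops move to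
   [s (mkseq r k.+1)]. *)
Definition captured n sigma (rho : nat) (s : strategy n sigma) (r : nat -> G)
    (k : nat) : Prop :=
  exists i, (dist (r k) (s (mkseq r k.+1) i) <= rho)%N.

(* The values of [r] after a capture play no role. *)
Definition robber_play n sigma (rho psi : nat) (s : strategy n sigma)
    (r : nat -> G) : Prop :=
  forall k, (forall j, (j <= k)%N -> ~ captured rho s r j) ->
    robber_move rho psi (s (mkseq r k.+1)) (r k) (r k.+1).

Definition winning n sigma (rho psi : nat) (v : G) (rad : nat)
    (s : strategy n sigma) : Prop :=
  forall r, robber_play rho psi s r ->
    (exists k, captured rho s r k) \/
    (exists2 N, (0 < N)%N & forall k, (N <= k)%N -> (rad < dist v (r k))%N).

Definition cop_win (n sigma rho psi rad : nat) : Prop :=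
  forall v : G, exists s : strategy n sigma, winning rho psi v rad s.

Definition strong_cop_win (n : nat) : Prop :=
  exists2 sigma, (0 < sigma)%N &
  forall psi, (0 < psi)%N ->
  exists rho, forall rad, (0 < rad)%N -> cop_win n sigma rho psi rad.

Definition sCop : option nat := least (fun n => (0 < n)%N /\ strong_cop_win n).

End CopsAndRobber.

Section Hyperbolicity.
Variables (R : realType) (X : Type) (d : X -> X -> R).

Definition geodesic_segment (x y : X) (S : set X) : Prop :=
  exists (l : R) (c : R -> X),
    [/\ 0 <= l, c 0 = x, c l = y,
        {in `[0, l] &, forall s t, d (c s) (c t) = `|s - t|}
      & S = c @` [set` `[0, l]]].

Definition neighborhood (delta : R) (S : set X) : set X :=
  [set p | exists2 q, S q & d p q <= delta].

Definition slim (delta : R) (A B C : set X) : Prop :=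
  [/\ A `<=` neighborhood delta (B `|` C),
      B `<=` neighborhood delta (C `|` A)
    & C `<=` neighborhood delta (A `|` B)].

(* Meant for geodesic metric spaces; connected metric graphs are such. *)
Definition hyperbolic_space : Prop :=
  exists2 delta : R, 0 <= delta &
  forall x y z A B C, geodesic_segment x y A -> geodesic_segment y z B ->
    geodesic_segment z x C -> slim delta A B C.

End Hyperbolicity.

Section MetricGraph.
Variables (R : realType) (G : graph).

(* Barycentric coordinates of the point at parameter [t] of the edge from [u]
   to [v]; when [u = v] this is the vertex [u] itself. *)
Definition edge_point (u v : G) (t : R) : G -> R :=
  fun w => (1 - t) * (`[< w = u >])%:R + t * (`[< w = v >])%:R.

Definition realization : Type :=
  {x : G -> R | exists u v t,
    [/\ u = v \/ adj u v, 0 <= t <= 1 & x = edge_point u v t]}.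

(* [polyline x y l]: some concatenation of finitely many linear segments, each
   inside an edge of length one, joins [x] to [y] and has total length [l]. *)
Inductive polyline : (G -> R) -> (G -> R) -> R -> Prop :=
| polyline_nil x : polyline x x 0
| polyline_cons u v s t y l :
    adj u v -> 0 <= s <= 1 -> 0 <= t <= 1 ->
    polyline (edge_point u v t) y l ->
    polyline (edge_point u v s) y (`|s - t| + l).

Definition path_metric (x y : realization) : R :=
  inf [set l | polyline (sval x) (sval y) l].

Definition hyperbolic_graph : Prop := hyperbolic_space path_metric.

End MetricGraph.

(* Main.v *)
Require Import Defs.
From mathcomp Require Import all_boot all_order all_algebra.
From mathcomp Require Import boolp classical_sets set_interval reals.
From mathcomp Require Import zify lra.

(** One cop, whose speed depends only on the hyperbolicity constant, pushes the
    robber away from [v]: it starts at [v], and after each of its moves it sits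
    on a geodesic from [v] to the robber, one step further from [v] than before.
    As long as the robber is free, it is therefore at distance at least [k] from
    [v] in stage [k], so it eventually leaves every ball around [v].

    The cop can keep this up because triangles are slim. Let the cop be at [c],
    on a geodesic from [v] to [r], when the robber runs from [r] to [r'] in at
    most [psi] steps. By [vertex_slim], [c] is within a constant [D] of a
    vertex [q] on a geodesic from [r] to [r'] or from [v] to [r']. The first
    case is excluded if the reach exceeds [psi + D], since the robber was not
    captured at [r]. In the second case the reach also forces [q] to be far
    from [r'], so the geodesic from [v] to [r'] through [q] has a vertex at
    distance [dist v c + 1] from [v]; that vertex is within [D + 1] of [q], hence
    within [2 D + 1] of [c] ([advance_exists]). The speed [2 D + 1] depends
    neither on [psi] nor on the radius of the ball, and the reach
    [psi + 2 D + 1] does not depend on that radius, as the order of the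
    quantifiers requires.

    It remains to pass from the metric realization to vertices. A shortest path
    run at unit speed is a geodesic of the realization ([walk_metric]), because
    a polyline between two vertices is never shorter than their path distance
    ([polyline_dist_le]); conversely, points near such a curve are near its
    vertices ([near_walk_image]). *)

Set Implicit Arguments.
Unset Strict Implicit.
Unset Printing Implicit Defensive.

Import Order.TTheory GRing.Theory Num.Theory.

(** * Path distance and geodesic walks *)

Section PathDistance.
Variable G : graph.
Hypothesis G_connected : connected_graph G.
Implicit Types u v x a b c : G.

Lemma shortest_path u v : exists2 p, is_path u v p & size p = dist u v.
Proof.
have [p0 p0P] := G_connected u v.
rewrite /dist /least; case: pselect => [exP|[]].
  by case: ex_minnP => n /asboolP.
by exists (size p0); apply/asboolP; exists p0.
Qed.

Lemma dist_le_path u v p : is_path u v p -> dist u v <= size p.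
Proof.
move=> pP; rewrite /dist /least; case: pselect => [exP|//].
by case: ex_minnP => n _; apply; apply/asboolP; exists p.
Qed.

Lemma distvv u : dist u u = 0.
Proof.
by apply/eqP; rewrite -leqn0; apply: (@dist_le_path u u [::]).
Qed.

Lemma dist_triangle v u x : dist u x <= dist u v + dist v x.
Proof.
have [p [pp lp] <-] := shortest_path u v.
have [q [qp lq] <-] := shortest_path v x.
rewrite -size_cat; apply: dist_le_path.
by split; [rewrite cat_path pp lp | rewrite last_cat lp].
Qed.

Lemma dist_sym u v : dist u v = dist v u.
Proof.
suff le_dist a b : dist b a <= dist a b.
  by apply/eqP; rewrite eqn_leq !le_dist.
have [p [pp lp] <-] := shortest_path a b.
rewrite -(size_belast a) -size_rev; apply: dist_le_path; split.
  rewrite -lp rev_path; apply: sub_path pp => y z.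
  by rewrite adj_sym.
by case: p lp {pp} => [|y p] //= _; rewrite rev_cons last_rcons.
Qed.

Lemma dist_adj u v : adj u v -> dist u v <= 1.
Proof. by move=> uv; apply: (@dist_le_path u v [:: v]); split; rewrite //= uv. Qed.

(** The vertex [c] lies on some geodesic from [u] to [x]. *)
Definition between u c x := dist u c + dist c x = dist u x.

Lemma between_left u x : between u u x.
Proof. by rewrite /between distvv. Qed.

Lemma between_sym u c x : between u c x -> between x c u.
Proof. by rewrite /between (dist_sym x c) (dist_sym c u) (dist_sym x u); lia. Qed.

Definition lazy_walk (w : nat -> G) := forall n, w n = w n.+1 \/ adj (w n) (w n.+1).

(** Allowing a walk to pause lets it be indexed by all of [nat]: after reaching
    its end a geodesic simply stays there. *)
Lemma geodesic_walk u c x : between u c x ->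
  exists w, [/\ lazy_walk w, w 0 = u, w (dist u c) = c & w (dist u x) = x].
Proof.
rewrite /between => ucx.
have [p [pp lp] sp] := shortest_path u c.
have [q [qp lq] sq] := shortest_path c x.
have pqp : path adj u (p ++ q) by rewrite cat_path pp lp.
have pql : last u (p ++ q) = x by rewrite last_cat lp.
exists (fun n => nth x (u :: p ++ q) n); split=> //.
- move=> n; case: (ltnP n (size (p ++ q))) => [nlt|nge].
    by right; apply: (pathP x pqp).
  left; rewrite [RHS]nth_default //; move: nge; rewrite leq_eqVlt.
  case/predU1P=> [<-|nlt]; last by rewrite nth_default.
  by rewrite -[size _]/(size (u :: p ++ q)).-1 nth_last.
- rewrite -sp -cat_cons nth_cat /= ltnSn.
  by rewrite -[X in nth _ _ X]/(size (u :: p)).-1 nth_last.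
- rewrite -ucx -sp -sq -size_cat.
  by rewrite -[X in nth _ _ X]/(size (u :: p ++ q)).-1 nth_last.
Qed.

Lemma lazy_walk_dist w i j : lazy_walk w -> i <= j -> dist (w i) (w j) <= j - i.
Proof.
move=> wP; elim: j => [|j IH] ij.
  by move: ij; rewrite leqn0 => /eqP->; rewrite distvv.
move: ij; rewrite leq_eqVlt => /predU1P[->|ij]; first by rewrite distvv.
have := IH ij; have := dist_triangle (w j) (w i) (w j.+1).
case: (wP j) => [<-|/dist_adj]; rewrite ?distvv; lia.
Qed.

Lemma geodesic_walk_between w u x i : lazy_walk w -> w 0 = u ->
  w (dist u x) = x -> i <= dist u x -> dist u (w i) = i /\ between u (w i) x.
Proof.
move=> wP w0 wx ix.
have := lazy_walk_dist wP (leq0n i); rewrite w0.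
have := lazy_walk_dist wP ix; rewrite wx.
have := dist_triangle (w i) u x; rewrite /between; lia.
Qed.

End PathDistance.

Local Open Scope classical_set_scope.
Local Open Scope ring_scope.

(** * Metric realization *)

Section Realization.
Variables (R : realType) (G : graph).
Implicit Types (u v a b c : G) (s t l : R) (x y z : G -> R) (w : nat -> G).

Definition vertex_point u : G -> R := edge_point u u 0.

Lemma edge_pointC u v t : edge_point u v t = edge_point v u (1 - t).
Proof. by apply/funext => a; rewrite /edge_point; lra. Qed.

Lemma edge_point_loop u t : edge_point u u t = vertex_point u.
Proof. by apply/funext => a; rewrite /vertex_point /edge_point; lra. Qed.

Lemma edge_point0 u v : edge_point u v (0 : R) = vertex_point u.
Proof. by apply/funext => a; rewrite /vertex_point /edge_point; lra. Qed.

Lemma edge_point1 u v : edge_point u v (1 : R) = vertex_point v.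
Proof. by apply/funext => a; rewrite /vertex_point /edge_point; lra. Qed.

Lemma edge_point_left u v t : u <> v -> edge_point u v t u = 1 - t.
Proof. by move=> uv; rewrite /edge_point asboolT // asboolF //=; lra. Qed.

Lemma vertex_point_at u a : vertex_point u a = (`[< a = u >])%:R.
Proof. by rewrite /vertex_point /edge_point; lra. Qed.

Lemma polyline_ge0 x y l : polyline x y l -> 0 <= l.
Proof.
by elim=> {x y l} // u v s t y l _ _ _ _ IH; have := normr_ge0 (s - t); lra.
Qed.

Lemma polyline_cat x y z l l' :
  polyline x y l -> polyline y z l' -> polyline x z (l + l').
Proof.
elim=> {x y l} [x|u v s t y l uv s01 t01 _ IH] yz; first by rewrite add0r.
by rewrite -addrA; apply: polyline_cons => //; apply: IH.
Qed.

Lemma polyline_edge u v s t : adj u v -> 0 <= s <= 1 -> 0 <= t <= 1 ->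
  polyline (edge_point u v s) (edge_point u v t) `|s - t|.
Proof.
move=> uv s01 t01; rewrite -[X in polyline _ _ X]addr0.
by apply: polyline_cons => //; apply: polyline_nil.
Qed.

Lemma polyline_sym x y l : polyline x y l -> polyline y x l.
Proof.
elim=> {x y l} [x|u v s t y l uv s01 t01 _ IH]; first exact: polyline_nil.
by rewrite addrC distrC; apply: polyline_cat IH _; apply: polyline_edge.
Qed.

Lemma adj_neq u v : adj u v -> u <> v.
Proof. by move=> uv eq_uv; move: uv; rewrite eq_uv adj_irrefl. Qed.

(** The point at time [t] of the walk [w] run at unit speed. *)
Definition walk_point w t : G -> R :=
  edge_point (w (Num.truncn t)) (w (Num.truncn t).+1) (t - (Num.truncn t)%:R).

Lemma walk_pointE w n t : n%:R <= t <= n.+1%:R ->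
  walk_point w t = edge_point (w n) (w n.+1) (t - n%:R).
Proof.
move=> /andP[nt]; rewrite le_eqVlt => /predU1P[->|tn]; rewrite /walk_point.
  by rewrite natrK subrr edge_point0 -natr1 addrC addKr edge_point1.
by rewrite (@truncn_def _ t n) ?nt.
Qed.

Lemma walk_point_nat w n : walk_point w n%:R = vertex_point (w n).
Proof. by rewrite /walk_point natrK subrr edge_point0. Qed.

(** A pause of the walk is covered by an empty polyline, so the length is
    bounded by the elapsed time without being equal to it. *)
Lemma walk_polyline w s t : lazy_walk w -> 0 <= s -> s <= t ->
  exists2 l, l <= t - s & polyline (walk_point w s) (walk_point w t) l.
Proof.
move=> wP.
have step n (a b : R) : n%:R <= a -> a <= b -> b <= n.+1%:R ->
    exists2 l, l <= b - a & polyline (walk_point w a) (walk_point w b) l.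
  move=> na ab bn; have := bn; rewrite -natr1 => bn'.
  rewrite !(@walk_pointE w n); try by apply/andP; split=> //; lra.
  case: (wP n) => [<-|wn].
    by rewrite !edge_point_loop; exists 0; [lra | apply: polyline_nil].
  exists `|a - n%:R - (b - n%:R)|; first by rewrite ler0_norm; lra.
  by apply: polyline_edge => //; lra.
suff upto n : forall a b : R, 0 <= a -> a <= b -> b <= n%:R ->
    exists2 l, l <= b - a & polyline (walk_point w a) (walk_point w b) l.
  by move=> s0 st; apply: (upto (Num.truncn t).+1) => //; apply/ltW/truncnS_gt.
elim: n => [|n IH] a b a0 ab bn.
  have -> : b = a by lra.
  by exists 0; [lra | apply: polyline_nil].
have [bn'|/ltW nb] := leP b n%:R; first exact: IH.
have [an|/ltW na] := leP a n%:R; last exact: (step n).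
have [l1 l1P p1] := IH a n%:R a0 an (lexx _).
have [l2 l2P p2] := step n n%:R b (lexx _) nb bn.
by exists (l1 + l2); [lra | apply: polyline_cat p1 p2].
Qed.

Lemma edge_point_realized u v t : u = v \/ adj u v -> 0 <= t <= 1 ->
  exists x : realization R G, sval x = edge_point u v t.
Proof.
move=> uv t01; suff xP : exists u' v' t', [/\ u' = v' \/ adj u' v', 0 <= t' <= 1
    & edge_point u v t = edge_point u' v' t'].
  by exists (exist _ (edge_point u v t) xP).
by exists u, v, t.
Qed.

(** Only the values of the curve at nonnegative times are constrained: before
    time 0 the parameter [t] is not an edge coordinate, and [walk_point w t] may
    fall outside the realization. *)
Lemma walk_curve w : lazy_walk w ->
  exists c : R -> realization R G, forall t, 0 <= t -> sval (c t) = walk_point w t.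
Proof.
move=> wP; suff /choice[c cP] : forall t, exists x : realization R G,
    0 <= t -> sval x = walk_point w t by exists c.
move=> t; have [t0|t0] := leP 0 t.
  have t01 : 0 <= t - (Num.truncn t)%:R <= 1.
    by have := truncn_itv t0; rewrite -natr1; lra.
  by have [x xE] := edge_point_realized (wP (Num.truncn t)) t01; exists x.
have [|x _] := @edge_point_realized (w 0) (w 0) 0 (or_introl erefl); first lra.
by exists x.
Qed.

Hypothesis G_connected : connected_graph G.

(** The induction on polylines passes through interior points of edges, whence
    the correction term: when [0 < x a], the point [x] lies on an edge at [a],
    at distance [1 - x a] from it. *)
Lemma polyline_dist_le x u l a : polyline x (vertex_point u) l ->
  0 < x a -> (dist a u)%:R <= l + (1 - x a).
Proof.
move yE: (vertex_point u) => y xyl; elim: xyl yE a => {x y l}.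
  move=> x <- a; rewrite vertex_point_at.
  by case: asboolP => [->|_]; rewrite ?distvv //= ?ltxx; lra.
move=> v b s t y l vb s01 t01 _ IH yE a.
have {IH}IH := IH yE.
(* [edge_pointC] exchanges the two ends of the edge, so [a] may be assumed to
   be its first end *)
suff from_end v' b' s' t' : adj v' b' -> 0 <= s' <= 1 -> 0 <= t' <= 1 ->
    (forall a, 0 < edge_point v' b' t' a ->
       (dist a u)%:R <= l + (1 - edge_point v' b' t' a)) ->
    0 < edge_point v' b' s' v' ->
    (dist v' u)%:R <= `|s' - t'| + l + (1 - edge_point v' b' s' v').
  have [->|av] := pselect (a = v); first exact: from_end.
  have [->|ab] := pselect (a = b).
    rewrite edge_pointC (_ : s - t = 1 - t - (1 - s)); last by lra.
    rewrite distrC; apply: from_end; rewrite 1?adj_sym //; try lra.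
    by move=> a'; rewrite -edge_pointC; apply: IH.
  by rewrite /edge_point !asboolF //=; lra.
move=> {vb s01 t01 IH v b s t} vb s01 t01 IH.
have vb_neq := adj_neq vb.
rewrite edge_point_left // => s1.
have := ler_norm (t' - s'); rewrite distrC => t_le.
have [t1|t1] := ltP t' 1.
  by have := IH v'; rewrite edge_point_left // => /(_ ltac:(lra)); lra.
(* the first segment ends at [b'], where nothing is known about the distance
   from [v']: step back along the edge *)
have tE : t' = 1 by lra.
have := IH b'; rewrite tE edge_point1 vertex_point_at asboolT //= ltr01.
move=> /(_ isT); have := dist_triangle G_connected b' v' u.
have := dist_adj vb; rewrite -(ler_nat R) => d1.
rewrite -(ler_nat R) natrD => d2 d3; move: t_le; rewrite tE => t_le.
lra.
Qed.

Lemma vertex_polyline u v :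
  exists l : R, polyline (vertex_point u) (vertex_point v) l.
Proof.
have [w [wP w0 _ wv]] := geodesic_walk G_connected (between_left u v).
have [l _ pl] := @walk_polyline w 0 (dist u v)%:R wP (lexx _) (ler0n _ _).
by exists l; rewrite -w0 -wv -!walk_point_nat.
Qed.

Lemma vertex_polyline_dist u v l :
  polyline (vertex_point u) (vertex_point v) l -> (dist u v)%:R <= l.
Proof.
move=> /(polyline_dist_le (a := u)); rewrite vertex_point_at asboolT //= ltr01.
by move=> /(_ isT); lra.
Qed.

(** The curve [c] is the walk [w] run at unit speed, where [w] reaches [v] from
    [u] in the least possible time and then may go anywhere. *)
Definition walk_image w u v (c : R -> realization R G) : Prop :=
  [/\ lazy_walk w, w 0 = u, w (dist u v) = v
    & forall t, 0 <= t -> sval (c t) = walk_point w t].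

(** Running along the whole walk and replacing its part between times [s] and
    [t] by a polyline must not yield a shortcut between its end vertices, and
    this bounds the length of that polyline from below. *)
Lemma walk_metric w u v (c : R -> realization R G) : walk_image w u v c ->
  {in `[0, (dist u v)%:R] &, forall s t, path_metric (c s) (c t) = `|s - t|}.
Proof.
case=> wP w0 wv cP s t; rewrite !in_itv /=.
set L : R := (dist u v)%:R => /andP[s0 sL] /andP[t0 tL].
rewrite /path_metric !cP //.
have lower (a b l : R) : 0 <= a -> a <= b -> b <= L ->
    polyline (walk_point w a) (walk_point w b) l -> b - a <= l.
  move=> a0 ab bL pl.
  have [l1 l1P p1] := walk_polyline wP (lexx 0) a0.
  have [l2 l2P p2] := walk_polyline wP (le_trans a0 ab) bL.
  have := polyline_cat (polyline_cat p1 pl) p2.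
  rewrite -(mulr0n 1) !walk_point_nat w0 wv => /vertex_polyline_dist.
  by rewrite -/L; lra.
suff both : (exists2 l, l <= `|s - t| & polyline (walk_point w s) (walk_point w t) l)
    /\ forall l, polyline (walk_point w s) (walk_point w t) l -> `|s - t| <= l.
  have [[l lP pl] lb] := both.
  apply/eqP; rewrite eq_le; apply/andP; split; last first.
    by apply: lb_le_inf; [exists l | exact: lb].
  apply: le_trans lP; apply: ge_inf => //.
  by exists 0 => m /polyline_ge0.
have [st|/ltW ts] := leP s t.
  rewrite ler0_norm ?opprB; last by lra.
  by split=> [|l]; [apply: walk_polyline | apply: lower].
rewrite ger0_norm; last by lra.
split=> [|l /polyline_sym]; last by apply: lower.
have [l lP pl] := walk_polyline wP t0 ts.
by exists l => //; apply: polyline_sym.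
Qed.

Lemma walk_geodesic_segment w u v (c : R -> realization R G) : walk_image w u v c ->
  geodesic_segment (@path_metric R G) (c 0) (c (dist u v)%:R)
    (c @` [set` `[0, (dist u v)%:R]]).
Proof.
by move=> im; exists (dist u v)%:R, c; split=> //; apply: walk_metric im.
Qed.

Lemma geodesic_image u v : exists w (c : R -> realization R G), walk_image w u v c.
Proof.
have [w [wP w0 _ wv]] := geodesic_walk G_connected (between_left u v).
by have [c cP] := walk_curve wP; exists w, c.
Qed.

Lemma realization_eq (x y : realization R G) : sval x = sval y -> x = y.
Proof.
move: x y => [x xP] [y yP] /= xy; subst y.
by congr exist; apply: Prop_irrelevance.
Qed.

(** Rounding the time [t] down to an integer replaces the point of the curve by
    a vertex at distance at most 1; the other 1 makes room for approximating
    the infimum that defines the path metric. *)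
Lemma near_walk_image w u v (c : R -> realization R G) (x : realization R G) q
    (delta : R) : walk_image w u v c ->
  sval x = vertex_point q ->
  neighborhood (@path_metric R G) delta (c @` [set` `[0, (dist u v)%:R]]) x ->
  exists2 q', between u q' v & (dist q q')%:R <= delta + 2.
Proof.
case=> wP w0 wv cP xq [_ [t tI <-] xt]; move: tI; rewrite /= in_itv /= => /andP[t0 tL].
pose n := Num.truncn t.
have /andP[nt tn] : n%:R <= t < n.+1%:R by apply: truncn_itv.
exists (w n).
  have [] // := geodesic_walk_between G_connected wP w0 wv (i := n).
  by rewrite -(ler_nat R); apply: le_trans tL.
have [l1 l1P p1] := walk_polyline wP (ler0n _ n) nt.
rewrite walk_point_nat in p1.
have [l0 p0] := vertex_polyline q (w n).
have [l lP ltl] : exists2 l, polyline (sval x) (sval (c t)) l & l < delta + 1.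
  apply: inf_lt; last by apply: le_lt_trans xt _; rewrite ltrDl ltr01.
  by exists (l0 + l1); rewrite /= xq cP //; apply: polyline_cat p0 p1.
rewrite xq cP // in lP.
have := vertex_polyline_dist (polyline_cat lP (polyline_sym p1)).
by move: tn; rewrite -natr1; lra.
Qed.

(** * Slim triangles of vertices *)

(** The side from [v] to [r] is chosen among the geodesics that pass through [c],
    so that slimness applies to [c]; the two other sides are arbitrary, and
    rounding turns the nearby point of the realization into the vertex [q]. *)
Lemma vertex_slim : hyperbolic_graph R G ->
  exists D : nat, forall v r r' c, between v c r ->
    exists2 q, (dist c q <= D)%N & between r q r' \/ between v q r'.
Proof.
case=> delta delta0 slimP; exists (Num.bound (delta + 2)) => v r r' c vcr.
have [wA [wAP wA0 wAc wAr]] := geodesic_walk G_connected vcr.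
have [cA cAP] := walk_curve wAP.
have imA : walk_image wA v r cA by split.
have [wB [cB imB]] := geodesic_image r r'.
have [wC [cC imC]] := geodesic_image r' v.
have endpt w u (x : G) (c' : R -> realization R G) : walk_image w u x c' ->
    sval (c' 0) = vertex_point u /\ sval (c' (dist u x)%:R) = vertex_point x.
  case=> wP w0 wx c'P; rewrite !c'P // walk_point_nat wx.
  by rewrite -(mulr0n 1) walk_point_nat w0.
have [A0 A1] := endpt _ _ _ _ imA; have [B0 B1] := endpt _ _ _ _ imB.
have [C0 C1] := endpt _ _ _ _ imC.
have segA := walk_geodesic_segment imA.
have segB := walk_geodesic_segment imB; have segC := walk_geodesic_segment imC.
rewrite (_ : cB 0 = cA (dist v r)%:R) in segB; last by apply: realization_eq; rewrite B0.
rewrite (_ : cC 0 = cB (dist r r')%:R) in segC; last by apply: realization_eq; rewrite C0.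
rewrite (_ : cC (dist r' v)%:R = cA 0) in segC; last by apply: realization_eq; rewrite C1.
have [/(_ (cA (dist v c)%:R)) AP _ _] := slimP _ _ _ _ _ _ segA segB segC.
have cE : sval (cA (dist v c)%:R) = vertex_point c by rewrite cAP // walk_point_nat wAc.
have bound q : (dist c q)%:R <= delta + 2 -> (dist c q <= Num.bound (delta + 2))%N.
  move=> cq; rewrite -(ler_nat R); apply/ltW/(le_lt_trans cq)/archi_boundP; lra.
case: AP => [|y [yB|yC] d_le].
- exists (dist v c)%:R => //=; rewrite in_itv /= ler0n ler_nat.
  by rewrite -vcr leq_addr.
- have [|q qB /bound cq] := near_walk_image (delta := delta) imB cE; first by exists y.
  by exists q => //; left.
- have [|q qC /bound cq] := near_walk_image (delta := delta) imC cE; first by exists y.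
  by exists q => //; right; apply: between_sym.
Qed.

End Realization.

Local Close Scope ring_scope.

(** * The pursuit strategy *)

Section Pursuit.
Variables (G : graph) (D : nat).
Hypothesis G_connected : connected_graph G.
Hypothesis D_slim : forall v r r' c : G, between v c r ->
  exists2 q, dist c q <= D & between r q r' \/ between v q r'.
Implicit Types v r c : G.

(** The legal moves of the cop from [c] that make progress against a robber
    at [r]. *)
Definition advance v c r c' : Prop :=
  [/\ dist c c' <= D.*2.+1, dist v c' = (dist v c).+1 & between v c' r].

(** The cop regains a geodesic from [v] to the new position [r'] of the robber by
    passing through the vertex [q] that slimness provides. *)
Lemma advance_exists psi v c r r' : between v c r -> dist r r' <= psi ->
  psi + D.*2.+1 < dist r c -> psi + D.*2.+1 < dist r' c ->
  exists c', advance v c r' c'.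
Proof.
move=> vcr rr' rc r'c.
have dt := dist_triangle G_connected; have ds := dist_sym G_connected.
have [q cq [rqr'|vqr']] := D_slim r' vcr.
  (* then [c] would be at distance at most [D + psi] from [r] *)
  by have := dt q r c; rewrite (ds q c); move: rqr'; rewrite /between; lia.
have vc := dt q v c; have vq := dt c v q; have r'q := dt q r' c.
rewrite (ds q c) in vc r'q; rewrite (ds r' q) in r'q.
have [w [wP w0 wq wr']] := geodesic_walk G_connected vqr'.
have le_r' : (dist v c).+1 <= dist v r' by rewrite -vqr'; lia.
have [vc' bc'] := geodesic_walk_between G_connected wP w0 wr' le_r'.
exists (w (dist v c).+1); split=> //.
have := dt q c (w (dist v c).+1).
suff : dist q (w (dist v c).+1) <= D.+1 by lia.
rewrite -[X in dist X _]wq; case: (leqP (dist v q) (dist v c).+1) => h.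
  by have := lazy_walk_dist G_connected wP h; lia.
by rewrite ds; have := lazy_walk_dist G_connected wP (ltnW h); lia.
Qed.

(** When no vertex qualifies the cop stays put, so that the speed bound holds
    after every history, even one that no legal robber produces. *)
Definition next_position v c r : G :=
  if pselect (exists c', advance v c r c') is left exc' then projT1 (cid exc')
  else c.

Lemma next_position_advance v c r :
  (exists c', advance v c r c') -> advance v c r (next_position v c r).
Proof. by rewrite /next_position; case: pselect => // exc' _; case: cid. Qed.

Lemma next_position_speed v c r : dist c (next_position v c r) <= D.*2.+1.
Proof.
rewrite /next_position; case: pselect => [exc'|_]; last by rewrite distvv.
by case: cid => c' [].
Qed.

Definition pursuit_at v (h : seq G) (_ : 'I_1) : G := foldl (next_position v) v h.

Lemma pursuit_speed v h r i :
  dist (pursuit_at v h i) (pursuit_at v (rcons h r) i) <= D.*2.+1.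
Proof. by rewrite /pursuit_at foldl_rcons; apply: next_position_speed. Qed.

Definition pursuit v : strategy G 1 D.*2.+1 := Strategy (@pursuit_speed v).

(** If the robber is never captured, then in stage [k.+1] the cop is at distance
    [k.+1] from [v] on a geodesic to the robber ([shadow]); the robber is thus
    outside the ball of radius [rad] from stage [rad.+1] on. *)
Lemma pursuit_winning psi v rad : winning (psi + D.*2.+1) psi v rad (pursuit v).
Proof.
set rho := psi + D.*2.+1.
move=> r play; have [?|free] := pselect (exists k, captured rho (pursuit v) r k).
  by left.
have far k : rho < dist (r k) (pursuit v (mkseq r k.+1) ord0).
  by rewrite ltnNge; apply/negP => near; apply: free; exists k, ord0.
have posS k : pursuit v (mkseq r k.+1) ord0 =
    next_position v (pursuit v (mkseq r k) ord0) (r k).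
  by rewrite mkseqS; apply: foldl_rcons.
have shadow k : dist v (pursuit v (mkseq r k.+1) ord0) = k.+1 /\
    between v (pursuit v (mkseq r k.+1) ord0) (r k).
  elim: k => [|k [IHd IHb]].
    have far0 := far 0; rewrite posS in far0 *.
    have -> : pursuit v (mkseq r 0) ord0 = v by [].
    suff /next_position_advance[_] : exists c', advance v v (r 0) c' by rewrite distvv.
    have [w [wP w0 _ wr]] := geodesic_walk G_connected (between_left v (r 0)).
    (* at [v] the robber would be within reach after the first move, as that
       move covers at most [D.*2.+1 <= rho] *)
    have r0 : 1 <= dist v (r 0).
      have := next_position_speed v v (r 0).
      have := dist_triangle G_connected v (r 0) (next_position v v (r 0)).
      rewrite (dist_sym G_connected (r 0) v); move: far0.
      by rewrite /rho -[pursuit v _ _]/v; lia.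
    have [d1 b1] := geodesic_walk_between G_connected wP w0 wr r0.
    by exists (w 1); split; rewrite // ?distvv // d1; lia.
  rewrite posS; set c := pursuit v (mkseq r k.+1) ord0 in IHd IHb *.
  suff /next_position_advance[_ -> ?] : exists c', advance v c (r k.+1) c'.
    by rewrite IHd.
  have [p [pP sp out]] := play k (fun j _ cap => free (ex_intro _ j cap)).
  apply: (advance_exists (psi := psi) IHb).
  - exact: leq_trans (dist_le_path pP) sp.
  - exact: far.
  - have := out _ (leqnn _) ord0; rewrite -[size p]/(size (r k :: p)).-1 nth_last.
    by case: pP => _ /= ->.
right; exists rad.+1 => // k radk; have [dk bk] := shadow k.
by rewrite -bk dk; lia.
Qed.

End Pursuit.

Theorem theorem1 (R : realType) (G : graph) (G_connected : connected_graph G)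
    (G_hyperbolic : hyperbolic_graph R G) :
  sCop G = Some 1%N.
Proof.
have [D D_slim] := vertex_slim G_connected G_hyperbolic.
have win1 : strong_cop_win G 1.
  exists D.*2.+1 => // psi _; exists (psi + D.*2.+1) => rad _ v.
  by exists (pursuit D v); apply: pursuit_winning.
rewrite /sCop /least; case: pselect => [exP|[]]; last first.
  by exists 1; apply/asboolP.
case: ex_minnP => n /asboolP[n0 _] /(_ 1) min_n.
have {}min_n := min_n (introT (asboolP _) (conj isT win1)).
by congr Some; lia.
Qed.
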